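(* Let $s$ be a single BIPASS strip, played alone under normal play. (i) If $|s|=0$, then the first player loses (i.e. $s$ is a P-position). (ii) If $\Delta(s)=0$ and $|s|>0$, then the first player wins (i.e. $s$ is an N-position). (iii) If $\Delta(s)>0$, then Left wins regardless of who starts. (iv) If $\Delta(s)<0$, then Right wins regardless of who starts.
   Context: **BIPASS.** A strip is a finite word over $\{B,W\}$ ($B$ = black stone, $W$ = white stone). Dead stones are removed immediately: a white stone with no black stone to its left, and a black stone with no white stone to its right, are deleted. So a strip is either the empty word (the game $0$) or a word beginning with $B$ and ending with $W$. A Left move chooses a black stone at position $i$ and a white stone at position $j>i$ with no black stone strictly between them, and interchanges the two; a Right move chooses a black stone at position $i$ and a white stone at position $j>i$ with no white stone strictly between them, and interchanges the two. After a move, dead stones (all leading $W$'s and all trailing $B$'s) are deleted. Normal play: a player who cannot move loses. $|s|$ is the number of stones on $s$, and $\Delta(s)=w(s)-b(s)$, where $w(s)$ and $b(s)$ are the numbers of white and black stones of $s$. *)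

(* Defs.v *)
From HB Require Import structures.
From mathcomp Require Import all_boot all_order all_algebra.

Set Implicit Arguments.
Unset Strict Implicit.
Unset Printing Implicit Defensive.

Variant player := Left | Right.

Definition opponent (p : player) : player :=
  match p with Left => Right | Right => Left end.

(* Normal play. [wins_first move p s]: p forces a win from s when p is to move;
   [wins_second move p s]: p forces a win from s when the opponent is to move.
   Being the least fixpoint, a win is always reached after finitely many
   moves, by leaving the opponent without a move. *)
Inductive wins_first (T : Type) (move : player -> T -> T -> Prop)
    (p : player) : T -> Prop :=
  | WinsFirst s t of move p s t & wins_second move p t : wins_first move p s
with wins_second (T : Type) (move : player -> T -> T -> Prop)
    (p : player) : T -> Prop :=
  | WinsSecond s of (forall t, move (opponent p) s t -> wins_first move p t) :
      wins_second move p s.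

Definition P_position (T : Type) (move : player -> T -> T -> Prop) (s : T) :=
  forall p, wins_second move p s.

Definition N_position (T : Type) (move : player -> T -> T -> Prop) (s : T) :=
  forall p, wins_first move p s.

Definition wins_regardless (T : Type) (move : player -> T -> T -> Prop)
    (p : player) (s : T) :=
  wins_first move p s /\ wins_second move p s.

Variant stone := B | W.

Definition bool_of_stone (c : stone) : bool := if c is B then true else false.
Definition stone_of_bool (b : bool) : stone := if b then B else W.
Lemma bool_of_stoneK : cancel bool_of_stone stone_of_bool.
Proof. by case. Qed.
HB.instance Definition _ := Equality.copy stone (can_type bool_of_stoneK).

Definition stone_of_player (p : player) : stone :=
  match p with Left => B | Right => W end.

Definition drop_leading (c : stone) (s : seq stone) : seq stone :=
  drop (find (predC1 c) s) s.

(* The stones that are dead are exactly the leading W's and the trailing B's. *)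
Definition remove_dead (s : seq stone) : seq stone :=
  rev (drop_leading B (rev (drop_leading W s))).

(* Strips have no dead stones. *)
Definition is_strip (s : seq stone) : bool :=
  nilp s || (head W s == B) && (last B s == W).

Record strip := Strip { word :> seq stone; word_is_strip : is_strip word }.
HB.instance Definition _ := [isSub for word].

Lemma remove_dead_is_strip (s : seq stone) : is_strip (remove_dead s).
Proof.
have dropP c u : if drop_leading c u is x :: _ then x != c else true.
  by rewrite /drop_leading; elim: u => //= x u; case: (x =P c) => //= /eqP.
rewrite /remove_dead; have := dropP W s; set u := drop_leading W s => hu.
have := dropP B (rev u); set v := drop_leading B (rev u) => hv.
have /(congr1 rev) : rev u = take (find (predC1 B) (rev u)) (rev u) ++ v.
  by rewrite cat_take_drop.
rewrite revK rev_cat => Eu; case: v hv Eu => [|x v] //= xB Eu.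
rewrite /is_strip rev_cons last_rcons; apply/orP; right.
move: hu; rewrite Eu rev_cons cat_rcons; case: x xB {Eu} => // _.
by case: (rev v) => [|[] r].
Qed.

Definition strip_of_word (s : seq stone) : strip :=
  Strip (remove_dead_is_strip s).

Definition interchange (s : seq stone) (i j : nat) : seq stone :=
  set_nth W (set_nth W s i (nth W s j)) j (nth W s i).

(* Either player interchanges a black stone with a white stone to its right,
   passing over no stone of that player's own colour. The bound [j < size s]
   is needed since [nth] returns its default value W beyond the end of s. *)
Definition bipass_move (p : player) (s t : strip) : Prop :=
  exists i j : nat,
    [/\ i < j < size s, nth W s i = B, nth W s j = W,
        forall k, i < k < j -> nth W s k <> stone_of_player p
      & t = strip_of_word (interchange s i j)].

Definition Delta (s : seq stone) : int :=
  ((count_mem W s)%:Z - (count_mem B s)%:Z)%R.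

(* Main.v *)
Require Import Defs.
From mathcomp Require Import all_boot all_order all_algebra.
From mathcomp Require Import zify.

(** A Left move carries a black stone to the right over a run of white stones,
    and a Right move carries a white stone to the left over a run of black
    stones. The theorem rests on two facts about a strip [s].

    - If [s] is not empty and [0 <= Delta s], then Left can carry the last black
      stone past all the white stones that follow it, where it dies. If it was
      the only black stone, nothing is left and Right cannot move; otherwise no
      other stone dies and [Delta] grows by one ([Left_has_good_move]).

    - If [0 < Delta s], no Right move makes [Delta] negative or empties the
      strip, since a Right move kills at most one white stone
      ([Right_move_of_Delta_gt0]).

    So Left, moving first from a nonempty strip with [0 <= Delta s], always
    leaves Right either the empty strip or one with positive [Delta], and then
    gets back a nonempty strip with [0 <= Delta]. The play ends because each
    Left move of this kind removes a stone, while no move adds one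
    ([Left_wins_first]).

    Right is dealt with by symmetry: reading a strip from right to left with the
    two colours exchanged exchanges the two players and the sign of [Delta]
    ([wins_mirror]). *)

Set Implicit Arguments.
Unset Strict Implicit.
Unset Printing Implicit Defensive.

(** * Removing the dead stones *)

Definition recolour (c : stone) : stone := if c is B then W else B.

Lemma recolourK : involutive recolour.
Proof. by case. Qed.

Lemma drop_leading_split c u : exists a, u = nseq a c ++ drop_leading c u.
Proof.
elim: u => [|x u [a IHu]]; first by exists 0.
rewrite /drop_leading /=; case: eqP => [->|_] /=; last by exists 0.
by exists a.+1; rewrite /= {1}IHu.
Qed.

(** The default value [recolour c] of [head] lets [u] be empty, as it is when
    every stone dies. *)
Lemma drop_leading_nseq c a u :
  head (recolour c) u = recolour c -> drop_leading c (nseq a c ++ u) = u.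
Proof.
move=> hu; elim: a => [|a IHa] /=; last by rewrite /drop_leading /= eqxx.
by case: u hu => //= x u ->; rewrite /drop_leading /=; case: c.
Qed.

Lemma remove_dead_split w :
  exists a b, w = nseq a W ++ remove_dead w ++ nseq b B.
Proof.
have [a Ew] := drop_leading_split W w; exists a.
have [b Eu] := drop_leading_split B (rev (drop_leading W w)); exists b.
by rewrite {1}Ew -(revK (drop_leading W w)) {1}Eu rev_cat rev_nseq.
Qed.

(** With [remove_dead_split], this characterises [remove_dead w] as the only
    strip that yields [w] when padded with leading W's and trailing B's. *)
Lemma remove_dead_pad a b t :
  is_strip t -> remove_dead (nseq a W ++ t ++ nseq b B) = t.
Proof.
move=> st; rewrite /remove_dead drop_leading_nseq; last first.
  by case: t st => [|x t] /=; [case: b | case/andP=> /eqP].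
rewrite rev_cat rev_nseq drop_leading_nseq ?revK //.
case/lastP: t st => [|t x] //; rewrite /is_strip /nilp size_rcons /=.
by rewrite last_rcons rev_rcons => /andP[_ /eqP].
Qed.

(** * Moves as rewritings of words *)

Lemma interchange_cat u m v (x y : stone) :
  Defs.interchange (u ++ x :: m ++ y :: v) (size u) (size u + (size m).+1) =
  u ++ y :: m ++ x :: v.
Proof.
have nthm a b : nth W (u ++ a :: m ++ b :: v) (size u + (size m).+1) = b.
  by rewrite nth_cat ltnNge leq_addr addKn /= nth_cat ltnn subnn.
rewrite /Defs.interchange nthm nth_cat ltnn subnn /=.
have -> : set_nth W (u ++ x :: m ++ y :: v) (size u) y = u ++ y :: m ++ y :: v.
  by elim: u {nthm} => //= z u ->.
elim: u {nthm} => /= [|z u ->] //; congr cons.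
by elim: m => //= z m ->.
Qed.

(** The positions [i] and [j] cut the word at the two stones that are
    interchanged, so a move is determined by the three remaining factors. *)
Lemma bipass_moveP p (s t : strip) :
  bipass_move p s t <->
  exists u m v, [/\ word s = u ++ B :: m ++ W :: v,
    all (predC1 (stone_of_player p)) m
    & word t = remove_dead (u ++ W :: m ++ B :: v)].
Proof.
split=> [[i [j [/andP[lij ljs] si sj sk ->]]]|[u [m [v [Es mp Et]]]]].
  have lis := ltn_trans lij ljs.
  set u := take i s; set m := take (j - i.+1) (drop i.+1 s).
  set v := drop j.+1 s; exists u, m, v.
  have zu : size u = i by rewrite size_take lis.
  have zm : size m = j - i.+1.
    by rewrite size_take size_drop ltn_sub2r // (leq_ltn_trans lij).
  have Es : word s = u ++ B :: m ++ W :: v.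
    rewrite -{1}(cat_take_drop i s) (drop_nth W lis) si; congr (_ ++ _ :: _).
    rewrite -{1}(cat_take_drop (j - i.+1) (drop i.+1 s)); congr cat.
    by rewrite drop_drop subnK // (drop_nth W ljs) sj.
  split=> //.
    apply/(all_nthP W) => k; rewrite zm => lkm; apply/eqP => Ek.
    apply: (sk (i.+1 + k)); first by lia.
    by rewrite -Ek /m nth_take // nth_drop.
  rewrite /= -(interchange_cat u m v B W) -Es zu zm.
  by rewrite -subSn // subSS subnKC // ltnW.
exists (size u), (size u + (size m).+1); split.
- by rewrite Es size_cat /= size_cat /=; lia.
- by rewrite Es nth_cat ltnn subnn.
- by rewrite Es nth_cat ltnNge leq_addr addKn /= nth_cat ltnn subnn.
- move=> k /andP[luk lkm]; rewrite Es nth_cat ltnNge (ltnW luk) /=.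
  have {luk lkm} [k' -> lkm] : exists2 k', k - size u = k'.+1 & k' < size m.
    by exists (k - size u).-1; lia.
  by rewrite /= nth_cat lkm; apply/eqP; apply: (all_nthP W mp).
- by apply: val_inj; rewrite /= Et Es interchange_cat.
Qed.

(** * The mirror symmetry *)

Definition mirror (s : seq stone) : seq stone := rev (map recolour s).

Lemma mirrorK : involutive mirror.
Proof. by move=> s; rewrite /mirror map_rev revK (mapK recolourK). Qed.

Lemma mirror_cat s t : mirror (s ++ t) = mirror t ++ mirror s.
Proof. by rewrite /mirror map_cat rev_cat. Qed.

Lemma mirror_cons c s : mirror (c :: s) = rcons (mirror s) (recolour c).
Proof. by rewrite /mirror /= rev_cons. Qed.

Lemma mirror_nseq n c : mirror (nseq n c) = nseq n (recolour c).
Proof. by rewrite /mirror map_nseq rev_nseq. Qed.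

Lemma mirror_is_strip s : is_strip s -> is_strip (mirror s).
Proof.
case: s => // x s; case/lastP: s => [|s y]; first by case: x.
rewrite /is_strip /= last_rcons => /andP[/eqP-> /eqP->].
by rewrite mirror_cons -cats1 -cats1 mirror_cat /= cats1 last_rcons.
Qed.

Lemma remove_dead_mirror w : remove_dead (mirror w) = mirror (remove_dead w).
Proof.
have [a [b Ew]] := remove_dead_split w.
rewrite {1}Ew !mirror_cat !mirror_nseq -catA remove_dead_pad //.
exact/mirror_is_strip/remove_dead_is_strip.
Qed.

Definition mirror_strip (s : strip) : strip :=
  Strip (mirror_is_strip (word_is_strip s)).

Lemma mirror_stripK : involutive mirror_strip.
Proof. by move=> s; apply: val_inj; rewrite /= mirrorK. Qed.

Lemma Delta_mirror s : Delta (mirror s) = (- Delta s)%R.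
Proof.
rewrite /Delta /mirror !count_rev !count_map.
have -> : count (preim recolour (pred1 W)) s = count_mem B s.
  by apply: eq_count; case.
have -> : count (preim recolour (pred1 B)) s = count_mem W s.
  by apply: eq_count; case.
by rewrite GRing.opprB.
Qed.

Lemma opponentK : involutive opponent.
Proof. by case. Qed.

Lemma move_mirror p s t :
  bipass_move p s t -> bipass_move (opponent p) (mirror_strip s) (mirror_strip t).
Proof.
case/bipass_moveP=> u [m [v [Es mp Et]]]; apply/bipass_moveP.
have mirror_factors c d : mirror (u ++ c :: m ++ d :: v) =
    mirror v ++ recolour d :: mirror m ++ recolour c :: mirror u.
  by rewrite mirror_cat !mirror_cons mirror_cat mirror_cons -!cats1 -!catA.
exists (mirror v), (mirror m), (mirror u); split.
- by rewrite /= Es mirror_factors.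
- by rewrite /mirror all_rev all_map; apply: sub_all mp; case: p; case.
- by rewrite /= Et -remove_dead_mirror mirror_factors.
Qed.

Scheme wins_first_mut := Induction for wins_first Sort Prop
  with wins_second_mut := Induction for wins_second Sort Prop.

Lemma wins_mirror p s :
  (wins_first bipass_move p s ->
     wins_first bipass_move (opponent p) (mirror_strip s)) /\
  (wins_second bipass_move p s ->
     wins_second bipass_move (opponent p) (mirror_strip s)).
Proof.
pose mirrored (wins : _ -> _ -> strip -> Prop) s :=
  wins bipass_move (opponent p) (mirror_strip s).
have step1 s1 t : bipass_move p s1 t -> wins_second bipass_move p t ->
    mirrored (@wins_second strip) t -> mirrored (@wins_first strip) s1.
  by move=> /move_mirror mv _; apply: WinsFirst mv.
have step2 s1 :
    (forall t, bipass_move (opponent p) s1 t -> wins_first bipass_move p t) ->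
    (forall t, bipass_move (opponent p) s1 t -> mirrored (@wins_first strip) t) ->
    mirrored (@wins_second strip) s1.
  move=> _ IH; apply: WinsSecond => t /move_mirror.
  rewrite opponentK mirror_stripK => /IH.
  by rewrite /mirrored mirror_stripK.
split.
- exact: (wins_first_mut (P := fun s _ => mirrored (@wins_first strip) s)
    (P0 := fun s _ => mirrored (@wins_second strip) s)).
- exact: (wins_second_mut (P := fun s _ => mirrored (@wins_first strip) s)
    (P0 := fun s _ => mirrored (@wins_second strip) s)).
Qed.

(** * Left's strategy *)

Lemma last_black_split s : B \in s -> exists u m, s = u ++ B :: nseq m W.
Proof.
elim/last_ind: s => // s x IHs; rewrite mem_rcons inE.
case: x => [_|/= /IHs[u [m ->]]]; first by exists s, 0; rewrite cats1.
exists u, m.+1; rewrite -cats1 -catA /= cats1; congr (_ ++ _ :: _).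
by elim: m => //= m ->.
Qed.

(** Carrying the last black stone to the end of the strip kills it and, if
    there is another black stone, leaves both ends of the strip alive. *)
Lemma Left_has_good_move (s : strip) :
  0 < size s -> (0 <= Delta s)%R ->
  exists t, [/\ bipass_move Left s t, size t < size s
    & size t = 0 \/ (0 < Delta t)%R].
Proof.
move=> s_gt0 D_ge0.
have /andP[/eqP s_head /eqP s_last] : (head W s == B) && (last B s == W).
  by case/orP: (word_is_strip s) s_gt0 => // /nilP->.
have Bs : B \in word s.
  by case: (word s) s_head => //= x s' ->; rewrite mem_head.
have [u [[|m] Es]] := last_black_split Bs.
  by move: s_last; rewrite Es last_cat.
set t := strip_of_word (u ++ W :: nseq m W ++ [:: B]); exists t.
have mv : bipass_move Left s t.
  apply/bipass_moveP; exists u, (nseq m W), [::]; split=> //.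
    by rewrite Es; congr (_ ++ _ :: _); elim: (m) => //= n ->.
  by rewrite all_nseq orbT.
have [u0|u_neq0] := eqVneq u [::].
  have Et : word t = [::].
    by rewrite /t u0 /=; apply: (@remove_dead_pad m.+1 1 [::]).
  by rewrite Et; split=> //; left.
have Et : word t = u ++ nseq m.+1 W.
  rewrite /t /= -[LHS]/(remove_dead (u ++ nseq m.+1 W ++ nseq 1 B)) catA.
  apply: (@remove_dead_pad 0 1); apply/orP; right.
  move: s_head; rewrite Es; case: (u) u_neq0 => //= x u' _ ->.
  by rewrite last_cat /=; elim: (m).
split=> //; first by rewrite Et Es !size_cat /= size_nseq; lia.
right; move: D_ge0; rewrite /Delta Et Es !count_cat /= !count_nseq /=; lia.
Qed.

(** The white stone that Right carries ends up just before a black stone, and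
    the strip began with a black stone; hence at most one white stone dies, and
    [Delta] loses at most one. If the strip became empty, there would be one
    dead white stone at most, so [0 < Delta s] would exclude any black one. *)
Lemma Right_move_of_Delta_gt0 (s t : strip) :
  (0 < Delta s)%R -> bipass_move Right s t ->
  [/\ size t <= size s, 0 < size t & (0 <= Delta t)%R].
Proof.
move=> D_gt0 /bipass_moveP[u [m [v [Es mB Et]]]].
have s_head : head W s = B.
  case/orP: (word_is_strip s) => [/nilP s0|/andP[/eqP]//].
  by move: D_gt0; rewrite s0.
have [a [b]] := remove_dead_split (u ++ W :: m ++ B :: v); rewrite -Et => Ew.
have a_le1 : a <= 1.
  case: a Ew => [|[|a]] //; case: (u) Es s_head => [|x u'] /= -> /=.
    by case: (m) mB => [|[]].
  by move=> ->.
have := congr1 size Ew; have := congr1 (count_mem W) Ew.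
have := congr1 (count_mem B) Ew; move: D_gt0; rewrite /Delta Es.
rewrite !(count_cat, size_cat, count_nseq, size_nseq, size_cat, count_cat) /=.
rewrite !(count_cat, size_cat) /= => D_gt0 cB cW sz.
have [t0|_] := posnP (size t); last by split=> //; lia.
by move: cB cW; rewrite (size0nil t0) /=; lia.
Qed.

Lemma size0_wins_second p (s : strip) :
  size s = 0 -> wins_second bipass_move p s.
Proof.
by move=> s0; constructor=> t [i [j []]]; rewrite s0 andbC.
Qed.

Lemma Left_wins_first (s : strip) :
  0 < size s -> (0 <= Delta s)%R -> wins_first bipass_move Left s.
Proof.
have [n] := ubnP (size s); elim: n s => // n IHn s ltsn s_gt0 D_ge0.
have [t [mv lt_ts t_win]] := Left_has_good_move s_gt0 D_ge0.
apply: WinsFirst mv _; case: t_win => [/size0_wins_second//|D_gt0].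
constructor=> r /(Right_move_of_Delta_gt0 D_gt0)[le_rt r_gt0 Dr_ge0].
by apply: IHn => //; lia.
Qed.

Lemma Left_wins_regardless (s : strip) :
  (0 < Delta s)%R -> wins_regardless bipass_move Left s.
Proof.
move=> D_gt0; split.
  apply: Left_wins_first; last exact: Order.POrderTheory.ltW.
  by case: (word s) D_gt0.
constructor=> t /(Right_move_of_Delta_gt0 D_gt0)[_ t_gt0 D_ge0].
exact: Left_wins_first.
Qed.

Theorem proposition4 (s : strip) :
  [/\ size s = 0 -> P_position bipass_move s,
      Delta s = 0%R -> 0 < size s -> N_position bipass_move s,
      (0 < Delta s)%R -> wins_regardless bipass_move Left s
    & (Delta s < 0)%R -> wins_regardless bipass_move Right s].
Proof.
split.
- by move=> s0 p; apply: size0_wins_second.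
- move=> D0 s_gt0 [].
    by apply: Left_wins_first => //; rewrite D0.
  rewrite -(mirror_stripK s); apply: (wins_mirror Left _).1.
  apply: Left_wins_first; first by rewrite /= size_rev size_map.
  by rewrite Delta_mirror D0 GRing.oppr0.
- exact: Left_wins_regardless.
- move=> D_lt0; have [|first second] := @Left_wins_regardless (mirror_strip s).
    by rewrite Delta_mirror Num.Theory.oppr_gt0.
  rewrite -(mirror_stripK s).
  by split; [apply: (wins_mirror Left _).1 | apply: (wins_mirror Left _).2].
Qed.
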